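(* Suppose a backbend sequence $\tilde{\beta}$ converges from below to a $k$-cyclic backbend sequence $\beta$ for some $k \in \mathbb{N}$. Then, for all $p \in [0,1]$, we have $\theta^{\tilde{\beta}}_{\mathbb{H}}(p) > 0$ if and only if $\theta^{\beta}_{\mathbb{H}}(p) > 0$.
   Context: Let $d \geq 2$ and $\mathbb{Z}_+ = \mathbb{N}\cup\{0\}$. The $d$-dimensional body-centered cubic (BCC) lattice is the graph $(\mathbb{V},\mathbb{E})$ with vertex set $\mathbb{V} = \{x \in \mathbb{Z}^d : x_i \equiv x_j \ (\mathrm{mod}\ 2) \text{ for all } i,j\}$ and edge set $\mathbb{E}$ consisting of all unordered pairs $\langle x,y\rangle$ of vertices with $|x_1-y_1| = \cdots = |x_d-y_d| = 1$. Each edge is independently open with probability $p \in [0,1]$ and closed with probability $1-p$; $\mathbb{P}_p$ is the corresponding product measure. For $\widehat{\mathbb{V}} \subseteq \mathbb{V}$, a path in $\widehat{\mathbb{V}}$ is a sequence $x^0,\ldots,x^n$ of distinct vertices of $\widehat{\mathbb{V}}$ with $\langle x^i,x^{i+1}\rangle \in \mathbb{E}$; it is open if all its edges are open. The record level of a path $\pi = (x^0,\ldots,x^n)$ till $x^i$ is $h^i(\pi) = \max_{j \leq i} x^j_d$. A backbend sequence is a map $\beta : \mathbb{Z}_+ \to \mathbb{Z}_+\cup\{\infty\}$, with $\beta_i := \beta(i)$. For $x \in \widehat{\mathbb{V}}$ with $x_d \geq 0$, a path $\pi = (x^0 = x,\ldots,x^n)$ in $\widehat{\mathbb{V}}$ is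 a $\beta$-backbend path in $\widehat{\mathbb{V}}$ from $x$ to $x^n$ if $x^i_d \geq h^i(\pi) - \beta_{h^i(\pi)}$ for every $i$. Let $C^{\beta}_{\widehat{\mathbb{V}}}$ be the random set of $x \in \widehat{\mathbb{V}}$ such that there is an open $\beta$-backbend path in $\widehat{\mathbb{V}}$ from the origin $(0,\ldots,0)$ to $x$. Put $\theta^{\beta}_{\widehat{\mathbb{V}}}(p) = \mathbb{P}_p(|C^{\beta}_{\widehat{\mathbb{V}}}| = \infty)$. A backbend sequence $\beta$ is $k$-cyclic ($k\in\mathbb{N}$) if for all $i \in \{0,\ldots,k-1\}$, $\beta_{kn+i} = \beta_i \in \mathbb{Z}_+$ for all $n \in \mathbb{N}$. A backbend sequence $\tilde\beta$ converges from below to a $k$-cyclic backbend sequence $\beta$ if for all $i \in \{0,\ldots,k-1\}$, $\lim_{n\to\infty}\tilde\beta_{kn+i} = \beta_i$ and $\tilde\beta_{kn+i} \leq \beta_i$ for all $n \in \mathbb{Z}_+$. The half-space is $\mathbb{H} = \{x \in \mathbb{V} : x_d \geq 0\}$. *)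

(* Defs.v *)
From mathcomp Require Import all_boot all_order all_algebra.
From mathcomp Require Import finmap.
From mathcomp Require Import all_classical all_reals all_analysis.

Set Implicit Arguments.
Unset Strict Implicit.
Unset Printing Implicit Defensive.

Import Order.TTheory GRing.Theory Num.Theory.

Local Open Scope classical_set_scope.
Local Open Scope ring_scope.

(* Points of Z^d are row vectors. The dimension is written d.+1 so that the
   last coordinate x_d is the entry of index ord_max. *)
Definition height (d : nat) (x : 'rV[int]_d.+1) : int := x ord0 ord_max.

Definition bcc_vertex (d : nat) : set 'rV[int]_d.+1 :=
  [set x : 'rV[int]_d.+1 | forall i j, (x ord0 i = x ord0 j %[mod 2])%Z].

Definition bcc_adj (d : nat) (x y : 'rV[int]_d.+1) : Prop :=
  [/\ x \in @bcc_vertex d, y \in @bcc_vertex d &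
      forall i, `|x ord0 i - y ord0 i| = 1].

Definition bcc_edge (d : nat) : set {fset 'rV[int]_d.+1} :=
  [set e | exists x y, bcc_adj x y /\ e = [fset x; y]%fset].

Definition half_space (d : nat) : set 'rV[int]_d.+1 :=
  [set x : 'rV[int]_d.+1 | bcc_vertex x /\ 0 <= height x].

(* An edge e is open in the configuration w when w e = true. *)
Definition config (d : nat) : Type := @bcc_edge d -> bool.

Definition open_edge_events (d : nat) : set_system (config d) :=
  range (fun e : @bcc_edge d => [set w : config d | w e]).

Definition config_space (d : nat) := g_sigma_algebraType (@open_edge_events d).

(* P is the product over all edges of Bernoulli(p) measures, specified by its
   finite-dimensional marginals, which determine it uniquely on the product
   sigma-algebra. *)
Definition is_bernoulli_product (R : realType) (d : nat) (p : R)
    (P : probability (config_space d) R) : Prop :=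
  forall (A : {fset @bcc_edge d}) (a : @bcc_edge d -> bool),
    P [set w | forall e, e \in A -> w e = a e]
    = (\prod_(e <- A) bernoulli_pmf p (a e))%:E.

(* Z_+ with infinity added is option nat, None being infinity. *)
Definition backbend_seq : Type := nat -> one_point_compactification nat.

Definition le_infty (a b : one_point_compactification nat) : Prop :=
  match a, b with
  | _, None => True
  | None, Some _ => False
  | Some m, Some n => (m <= n)%N
  end.

Definition k_cyclic (k : nat) (beta : backbend_seq) : Prop :=
  forall i, (i < k)%N ->
    (exists m : nat, beta i = Some m) /\
    forall n, (0 < n)%N -> beta (k * n + i)%N = beta i.

Definition converges_from_below (k : nat) (beta' beta : backbend_seq) : Prop :=
  forall i, (i < k)%N ->
    ((fun n : nat => beta' (k * n + i)%N) @ \oo --> beta i) /\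
    forall n : nat, le_infty (beta' (k * n + i)%N) (beta i).

(* The sequence x :: s lists the vertices x^0, ..., x^n of a path, and
   nth x (x :: s) i is x^i. *)
Definition is_path (d : nat) (V' : set 'rV[int]_d.+1)
    (x : 'rV[int]_d.+1) (s : seq 'rV[int]_d.+1) : Prop :=
  [/\ uniq (x :: s),
      (forall y, y \in x :: s -> V' y) &
      forall i, (i < size s)%N ->
        bcc_adj (nth x (x :: s) i) (nth x (x :: s) i.+1)].

Definition is_open_path (d : nat) (w : config d)
    (x : 'rV[int]_d.+1) (s : seq 'rV[int]_d.+1) : Prop :=
  forall i, (i < size s)%N ->
    exists e : @bcc_edge d,
      val e = [fset nth x (x :: s) i; nth x (x :: s) i.+1]%fset /\ w e.

Definition record_level (d : nat) (x : 'rV[int]_d.+1)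
    (s : seq 'rV[int]_d.+1) (i : nat) : int :=
  \big[Num.max/height x]_(j < i.+1) height (nth x (x :: s) j).

(* Since 0 <= height x, record levels are nonnegative and the absolute value
   only serves to read them as natural numbers. *)
Definition is_backbend_path (d : nat) (beta : backbend_seq)
    (V' : set 'rV[int]_d.+1) (x : 'rV[int]_d.+1) (s : seq 'rV[int]_d.+1)
    : Prop :=
  [/\ 0 <= height x, is_path V' x s &
      forall i, (i <= size s)%N ->
        let h := record_level x s i in
        match beta `|h|%N return Prop with
        | Some b => h - b%:Z <= height (nth x (x :: s) i)
        | None => True
        end].

Definition backbend_cluster (d : nat) (beta : backbend_seq) (V' : set 'rV[int]_d.+1)
    (w : config d) : set 'rV[int]_d.+1 :=
  [set y | exists s, [/\ is_backbend_path beta V' 0 s,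
                         is_open_path w 0 s & last 0 s = y]].

Definition theta (R : realType) (d : nat) (P : probability (config_space d) R)
    (beta : backbend_seq) (V' : set 'rV[int]_d.+1) : \bar R :=
  P [set w | infinite_set (backbend_cluster beta V' w)].

(* Main.v *)
Require Import Defs.
From mathcomp Require Import all_boot all_order all_algebra.
From mathcomp Require Import finmap.
From mathcomp Require Import all_classical all_reals all_analysis.
From mathcomp Require Import zify.

Set Implicit Arguments.
Unset Strict Implicit.
Unset Printing Implicit Defensive.

Import Order.TTheory GRing.Theory Num.Theory.
Local Open Scope classical_set_scope.
Local Open Scope ring_scope.

(** One direction is monotonicity: lowering the backbend sequence shrinks the
cluster, and convergence from below to a periodic sequence gives
[beta' <= beta] everywhere.

For the other direction, the limits of [beta'] are finite, hence isolated points
of the one-point compactification, so along each of the finitely many residue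
classes mod [k] the sequence [beta'] is eventually equal to [beta].
As [beta] is periodic, deleting a suitable finite number of initial terms (a
multiple of [k]) turns [beta'] into [beta] itself. It is therefore enough to
show that deleting one initial term of a sequence [gamma] cannot turn a zero
percolation probability into a positive one when [p > 0]
([theta_shift_seq_le]):

  p * theta (shift_seq gamma) <= theta gamma.

To see this, let the path climb along the single edge from the origin to
[u = (1, ..., 1)], and continue with the translate by [u] of a
[shift_seq gamma]-backbend path that stays in the half-space. The translate
lives at heights at least 1, so it never meets the origin again, its record
levels are exactly one more than those of the original path, and the whole is a
[gamma]-backbend path ([backbend_cluster_shift]). The first edge has an endpoint
at height 0, so it is not an edge of the upper part, and the two requirements
are independent. Translation invariance and independence are obtained at one
stroke ([bernoulli_shift_config]): translation up by [u] on the edges of the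
half-space is extended to an injective map of all edges that avoids the first
edge, and reading a configuration through such a map gives a configuration with
the same law, independent of the first edge.

The case [p = 0] is settled by observing that almost surely no edge is open. *)

(** * Translations of the lattice *)

Definition diag (d : nat) : 'rV[int]_d.+1 := const_mx 1.

Lemma heightD (d : nat) (x y : 'rV[int]_d.+1) :
  height (x + y) = height x + height y.
Proof. by rewrite /height mxE. Qed.

Lemma heightN (d : nat) (x : 'rV[int]_d.+1) : height (- x) = - height x.
Proof. by rewrite /height mxE. Qed.

Lemma height0 (d : nat) : height (0 : 'rV[int]_d.+1) = 0.
Proof. by rewrite /height mxE. Qed.

Lemma height_diag (d : nat) : height (diag d) = 1.
Proof. by rewrite /height mxE. Qed.

Lemma bcc_vertexD (d : nat) (x v : 'rV[int]_d.+1) :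
  bcc_vertex x -> bcc_vertex v -> bcc_vertex (x + v).
Proof. by move=> hx hv i j; rewrite !mxE -modzDm (hx i j) (hv i j) modzDm. Qed.

Lemma bcc_vertex_diag (d : nat) : bcc_vertex (diag d).
Proof. by move=> i j; rewrite !mxE. Qed.

Lemma bcc_vertex_diagN (d : nat) : bcc_vertex (- diag d).
Proof. by move=> i j; rewrite !mxE. Qed.

Lemma bcc_adjD (d : nat) (v x y : 'rV[int]_d.+1) :
  bcc_vertex v -> bcc_adj x y -> bcc_adj (x + v) (y + v).
Proof.
move=> hv [/set_mem hx /set_mem hy xy]; split.
- exact/mem_set/bcc_vertexD.
- exact/mem_set/bcc_vertexD.
- move=> i; rewrite !mxE opprD addrACA subrr addr0; exact: xy.
Qed.

Lemma bcc_adj0_diag (d : nat) : bcc_adj 0 (diag d).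
Proof.
split; last by move=> i; rewrite !mxE.
- by apply/mem_set => i j; rewrite !mxE.
- exact/mem_set/bcc_vertex_diag.
Qed.

Definition translate_edge (d : nat) (v : 'rV[int]_d.+1)
    (e : {fset 'rV[int]_d.+1}) : {fset 'rV[int]_d.+1} :=
  [fset (x + v)%R | x in e]%fset.

Lemma mem_translate_edge (d : nat) (v : 'rV[int]_d.+1)
    (e : {fset 'rV[int]_d.+1}) (x : 'rV[int]_d.+1) :
  (x \in translate_edge v e) = (x - v \in e).
Proof.
apply/imfsetP/idP => [[y /= ye ->]|xe]; first by rewrite addrK.
by exists (x - v); rewrite //= subrK.
Qed.

Lemma translate_edge_inj (d : nat) (v : 'rV[int]_d.+1) :
  injective (translate_edge v).
Proof.
move=> e e' ee'; apply/fsetP => x.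
by rewrite -[x in LHS](addrK v) -[x in RHS](addrK v) -!mem_translate_edge ee'.
Qed.

Lemma translate_edge_fset2 (d : nat) (v x y : 'rV[int]_d.+1) :
  translate_edge v [fset x; y]%fset = [fset (x + v)%R; (y + v)%R]%fset.
Proof. by apply/fsetP => z; rewrite mem_translate_edge !inE !subr_eq. Qed.

Lemma diag_edge_subproof (d : nat) :
  ([fset 0; diag d] : {fset 'rV[int]_d.+1})%fset \in @bcc_edge d.
Proof.
by apply/mem_set; exists 0, (diag d); split=> //; exact: bcc_adj0_diag.
Qed.

Definition diag_edge (d : nat) : @bcc_edge d := SigSub (diag_edge_subproof d).

(** * An injection of the edges that avoids the diagonal edge *)

Definition upper (d : nat) (e : {fset 'rV[int]_d.+1}) : bool :=
  all (fun x => 0 <= height x) e.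

(** Edges of the half-space go up and all the others go down. The two families
of images stay separated by height, and between them room is made for the
edges with lower endpoint at height 0, among which is the diagonal edge. *)
Definition push_vec (d : nat) (e : {fset 'rV[int]_d.+1}) : 'rV[int]_d.+1 :=
  if upper e then diag d else - diag d.

Lemma push_edge_subproof (d : nat) (e : @bcc_edge d) :
  translate_edge (push_vec (val e)) (val e) \in @bcc_edge d.
Proof.
apply/mem_set; have /set_mem[x [y [xy exy]]] := valP e.
exists (x + push_vec (val e)), (y + push_vec (val e)); split; last first.
  by rewrite [in X in translate_edge _ X]exy translate_edge_fset2.
apply: bcc_adjD xy; rewrite /push_vec; case: ifP => _.
- exact: bcc_vertex_diag.
- exact: bcc_vertex_diagN.
Qed.

Definition push_edge (d : nat) (e : @bcc_edge d) : @bcc_edge d :=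
  SigSub (push_edge_subproof e).

Lemma upperP (d : nat) (e : {fset 'rV[int]_d.+1}) :
  reflect (forall x, x \in e -> 0 <= height x) (upper e).
Proof. exact: allP. Qed.

Lemma height_push_edge (d : nat) (e : @bcc_edge d) (x : 'rV[int]_d.+1) :
  upper (val e) -> x \in val (push_edge e) -> 1 <= height x.
Proof.
move=> ue ; rewrite /= /push_vec ue mem_translate_edge.
by move/upperP : ue => ue /ue; rewrite heightD heightN height_diag; lia.
Qed.

Lemma push_edge_lower (d : nat) (e : @bcc_edge d) :
  ~~ upper (val e) -> ~~ upper (val (push_edge e)).
Proof.
move=> ue; have /allPn[y ye hy] := ue.
apply/upperP => /(_ (y - diag d)) h.
have : y - diag d \in val (push_edge e).
  by rewrite /= /push_vec (negbTE ue) mem_translate_edge opprK subrK.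
by move/h; rewrite heightD heightN height_diag; lia.
Qed.

Lemma push_edge_upper (d : nat) (e : @bcc_edge d) :
  upper (val (push_edge e)) = upper (val e).
Proof.
apply/idP/idP; first by apply: contraTT; exact: push_edge_lower.
by move=> ue; apply/upperP => x /(height_push_edge ue); lia.
Qed.

(** Whether an edge was moved up or down can be read off its image, by
[push_edge_upper], so the translation can be undone. *)
Lemma push_edge_inj (d : nat) : injective (@push_edge d).
Proof.
move=> e e' ee'.
have ue : upper (val e) = upper (val e').
  by rewrite -push_edge_upper ee' push_edge_upper.
move/(congr1 val) : ee'; rewrite /= /push_vec -ue => /translate_edge_inj.
exact: val_inj.
Qed.

Lemma push_edge_neq_diag_edge (d : nat) (e : @bcc_edge d) :
  push_edge e != diag_edge d.
Proof.
apply/eqP => /(congr1 val) /= ee; have := push_edge_upper e.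
have z0 : 0 \in val (push_edge e) by rewrite /= ee !inE eqxx.
have -> : upper (val (push_edge e)).
  apply/upperP => x; rewrite /= ee !inE => /orP[]/eqP ->.
    by rewrite height0.
  by rewrite height_diag.
by move=> /esym ue; have := height_push_edge ue z0; rewrite height0.
Qed.

(** * Climbing one diagonal edge before following a path *)

Definition shift_seq (gamma : backbend_seq) : backbend_seq :=
  fun i => gamma i.+1.

Lemma le_record_level (d : nat) (x : 'rV[int]_d.+1) (s : seq 'rV[int]_d.+1)
    (i j : nat) :
  (j <= i)%N -> height (nth x (x :: s) j) <= record_level x s i.
Proof.
rewrite -ltnS => ji.
exact: (le_bigmax (height x) (fun j : 'I_i.+1 => height (nth x (x :: s) j))
  (Ordinal ji)).
Qed.

Lemma record_level_le (d : nat) (x : 'rV[int]_d.+1) (s : seq 'rV[int]_d.+1)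
    (i : nat) (m : int) :
  (forall j, (j <= i)%N -> height (nth x (x :: s) j) <= m) ->
  record_level x s i <= m.
Proof.
move=> h; apply: bigmax_le => [|j _]; first exact: (h 0%N).
by apply: h; rewrite -ltnS.
Qed.

Lemma record_level_start (d : nat) (x : 'rV[int]_d.+1)
    (s : seq 'rV[int]_d.+1) :
  record_level x s 0 = height x.
Proof.
apply/le_anti/andP; split; last exact: (le_record_level x s (leqnn 0)).
by apply: record_level_le => j; rewrite leqn0 => /eqP ->.
Qed.

(** The tail, after the origin, of the path that goes from the origin to
[diag d] and continues with the translate of [0 :: s]: the translated origin is
the end of the diagonal edge, and hence is part of the list. *)
Definition prepend_diag (d : nat) (s : seq 'rV[int]_d.+1) :
    seq 'rV[int]_d.+1 :=
  [seq y + diag d | y <- 0 :: s].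

Lemma nth_prepend_diag (d : nat) (s : seq 'rV[int]_d.+1) (i : nat) :
  (i <= size s)%N ->
  nth 0 (0 :: prepend_diag s) i.+1 = nth 0 (0 :: s) i + diag d.
Proof. by move=> si; rewrite [LHS](nth_map 0). Qed.

(** The new starting point at height 0 does not count, as it lies below the
second vertex, which is at height 1. *)
Lemma record_level_prepend (d : nat) (s : seq 'rV[int]_d.+1) (i : nat) :
  (i <= size s)%N ->
  record_level 0 (prepend_diag s) i.+1 = record_level 0 s i + 1.
Proof.
move=> si; apply/le_anti/andP; split.
  apply: record_level_le => -[_|j ji].
    have := le_record_level 0 s (leq0n i); rewrite !height0; lia.
  rewrite nth_prepend_diag ?(leq_trans _ si)// heightD height_diag lerD2r.
  exact: le_record_level.
rewrite -lerBrDr; apply: record_level_le => j ji.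
have := @le_record_level _ 0 (prepend_diag s) i.+1 j.+1 ji.
by rewrite nth_prepend_diag ?(leq_trans ji si)// heightD height_diag lerBrDr.
Qed.

(** The half-space is essential: it keeps the translated path at heights at
least 1, so that it cannot return to the origin. *)
Lemma is_path_prepend (d : nat) (s : seq 'rV[int]_d.+1) :
  is_path (@half_space d) 0 s -> is_path (@half_space d) 0 (prepend_diag s).
Proof.
move=> [us Hs adj]; split.
- rewrite cons_uniq (map_inj_uniq (addIr _)) us andbT.
  apply/negP => /mapP[y /Hs[_ hy]] /(congr1 (@height d)).
  by rewrite heightD height0 height_diag; lia.
- move=> y; rewrite in_cons => /orP[/eqP ->|/mapP[z /Hs[vz hz] ->]].
    by apply: Hs; rewrite mem_head.
  split; first exact/bcc_vertexD/bcc_vertex_diag.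
  by rewrite heightD height_diag; lia.
- rewrite size_map => -[_|i]; first by rewrite /= add0r; exact: bcc_adj0_diag.
  rewrite ltnS => si; rewrite !nth_prepend_diag ?(ltnW si)//.
  by apply: bcc_adjD; [exact: bcc_vertex_diag|exact: adj].
Qed.

(** After the first step heights and record levels both grow by one, so the
allowed backbend at record level [h] of the original path is the one prescribed
by [gamma] at [h + 1], that is, by [shift_seq gamma] at [h]. *)
Lemma is_backbend_path_prepend (d : nat) (gamma : backbend_seq)
    (s : seq 'rV[int]_d.+1) :
  is_backbend_path (shift_seq gamma) (@half_space d) 0 s ->
  is_backbend_path gamma (@half_space d) 0 (prepend_diag s).
Proof.
move=> [h0 ps bs]; split=> //; first exact: is_path_prepend.
rewrite size_map => -[_|i].
  rewrite record_level_start /= height0.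
  by case: (gamma _) => // b; lia.
rewrite ltnS => si; rewrite nth_prepend_diag // record_level_prepend //.
have := bs i si; have := le_record_level 0 s (leq0n i).
rewrite /= height0 /shift_seq; set r := record_level 0 s i => r0.
have -> : `|(r + 1)%R|%N = `|r|%N.+1 by lia.
by case: (gamma _) => // b; rewrite heightD height_diag; lia.
Qed.

(** On the edges of the half-space, this is the configuration seen from the
point [diag d]. *)
Definition shift_config (d : nat) (w : config d) : config d :=
  fun e => w (push_edge e).

Lemma is_open_path_prepend (d : nat) (w : config d) (s : seq 'rV[int]_d.+1) :
  is_path (@half_space d) 0 s -> w (diag_edge d) ->
  is_open_path (shift_config w) 0 s -> is_open_path w 0 (prepend_diag s).
Proof.
move=> [_ Hs _] w0 os; rewrite /is_open_path size_map => -[_|i].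
  by exists (diag_edge d); split=> //=; rewrite add0r.
rewrite ltnS => si; have [e [ee we]] := os i si.
exists (push_edge e); split=> //.
rewrite !nth_prepend_diag ?(ltnW si)//= ee -translate_edge_fset2 /push_vec.
rewrite ifT //; apply/upperP => x; rewrite !inE => /orP[]/eqP ->.
  by have [] // := Hs (nth 0 (0 :: s) i); rewrite mem_nth // ltnS ltnW.
by have [] // := Hs (nth 0 (0 :: s) i.+1); rewrite mem_nth // ltnS.
Qed.

(** The translate of the shifted cluster is part of the cluster. *)
Lemma backbend_cluster_shift (d : nat) (gamma : backbend_seq) (w : config d) :
  w (diag_edge d) ->
  infinite_set (backbend_cluster (shift_seq gamma) (@half_space d)
    (shift_config w)) ->
  infinite_set (backbend_cluster gamma (@half_space d) w).
Proof.
move=> w0 infC finC; apply: infC.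
have addI : injective (fun y : 'rV[int]_d.+1 => y + diag d) by exact: addIr.
apply: sub_finite_set (finite_preimage (in2W addI) finC) => y [s [bs os ys]].
exists (prepend_diag s); split.
- exact: is_backbend_path_prepend.
- by case: (bs) => _ ps _; exact: is_open_path_prepend.
- by rewrite -ys /=; exact: (last_map (fun z => z + diag d)).
Qed.

(** * Independence and translation invariance of the product measure *)

Lemma measurable_open_edge (d : nat) (e : @bcc_edge d) :
  measurable ([set w | w e] : set (config_space d)).
Proof. by apply: sub_sigma_algebra; exists e. Qed.

Definition all_open (d : nat) (A : {fset @bcc_edge d}) : set (config_space d) :=
  [set w | forall e, e \in A -> w e].

Lemma measurable_all_open (d : nat) (A : {fset @bcc_edge d}) :
  measurable (all_open A).
Proof.
apply: (fin_bigcap_measurable (F := fun e => [set w : config_space d | w e])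
  (finite_fset A)) => e _.
exact: measurable_open_edge.
Qed.

Lemma all_openU (d : nat) (A B : {fset @bcc_edge d}) :
  all_open (A `|` B)%fset = all_open A `&` all_open B.
Proof.
apply/seteqP; split=> [w ABw|w [Aw Bw] e].
  by split=> e eAB; apply: ABw; rewrite inE eAB ?orbT.
by rewrite inE => /orP[]; [exact: Aw|exact: Bw].
Qed.

(** The events that finitely many given edges are all open form a pi-system, so
a finite measure is determined by its values on them. Only open edges are
prescribed, which keeps the probabilities simple powers of [p]. *)
Lemma all_open_generate (d : nat) :
  (@measurable _ (config_space d) : set_system _) = <<s range (@all_open d) >>.
Proof.
apply/seteqP; split; last first.
  apply: smallest_sub; first exact: sigma_algebra_measurable.
  by move=> _ [A _ <-]; exact: measurable_all_open.
apply: smallest_sub; first exact: smallest_sigma_algebra.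
move=> _ [e _ <-]; apply: sub_sigma_algebra; exists [fset e]%fset => //.
apply/seteqP; split=> w /= ew; first by apply: ew; rewrite inE.
by move=> e'; rewrite inE => /eqP ->.
Qed.

Lemma bernoulli_all_open (R : realType) (d : nat) (p : R)
    (P : probability (config_space d) R) (A : {fset @bcc_edge d}) :
  is_bernoulli_product p P -> P (all_open A) = (p ^+ #|` A|)%:E.
Proof.
move=> /(_ A (fun=> true)) /=.
by rewrite big_const_seq count_predT -Monoid.iteropE.
Qed.

Lemma measurable_shift_config (d : nat) :
  measurable_fun setT (@shift_config d : config_space d -> config_space d).
Proof.
apply: (@measurability _ _ (config_space d) (config_space d) setT
  (@shift_config d) (@open_edge_events d)) => // _ [_ [e _ <-] <-].
by rewrite setTI; exact: measurable_open_edge.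
Qed.

(** Both sides are finite measures in [E], so it suffices to compare them on the
events [all_open A]. There the left side asks for the edges in the image of [A],
which are as many as those in [A] by injectivity, and for one more edge outside
that image. *)
Lemma bernoulli_shift_config (R : realType) (d : nat) (p : R)
    (P : probability (config_space d) R) (E : set (config_space d)) :
  0 <= p -> is_bernoulli_product p P -> measurable E ->
  P (@shift_config d @^-1` E `&` [set w : config_space d | w (diag_edge d)]) =
  (p%:E * P E)%E.
Proof.
move=> p0 hP mE.
pose m1 := pushforward (mrestr P (measurable_open_edge (diag_edge d)))
  (@shift_config d : config_space d -> config_space d).
pose m2 := mscale (NngNum p0) P.
have m1m2 A : m1 (all_open A) = m2 (all_open A).
  rewrite /m2 /mscale /= (bernoulli_all_open _ hP) -EFinM -exprS.
  rewrite /m1 /pushforward /mrestr.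
  set A' := (diag_edge d |` [fset push_edge e | e in A])%fset.
  have -> : @shift_config d @^-1` all_open A `&`
      [set w : config_space d | w (diag_edge d)] = all_open A'.
    apply/seteqP; split=> [w [Aw w0] e|w A'w].
      by rewrite !inE => /orP[/eqP -> //|/imfsetP[e' /= e'A ->]]; exact: Aw.
    split; last by apply: A'w; rewrite fset1U1.
    by move=> e eA; apply: A'w; rewrite fset1Ur// in_imfset.
  rewrite (bernoulli_all_open _ hP) cardfsU1.
  rewrite card_imfset; last exact: push_edge_inj.
  suff -> : diag_edge d \notin [fset push_edge e | e in A]%fset by [].
  apply/imfsetP => -[e _ ee].
  by have := push_edge_neq_diag_edge e; rewrite -ee eqxx.
have mT := @measurable_shift_config d.
(* The pushforward is a measure only by [mT], so [m1'] is a function of it. *)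
pose m1' : {measure set (config_space d) -> \bar R} := [the measure _ _ of m1].
apply: (@measure_unique _ _ _ (range (@all_open d)) (fun=> setT)
  (all_open_generate d) _ _ _ (m1' mT) m2 _ _ E mE).
- move=> _ _ [A _ <-] [B _ <-].
  by exists (A `|` B)%fset => //; exact: all_openU.
- move=> _; exists fset0 => //.
  by apply/seteqP; split=> // w _ e; rewrite inE.
- by rewrite bigcup_const.
- by move=> _ [A _ <-]; exact: m1m2.
- move=> _; rewrite /= /m1 /pushforward /mrestr preimage_setT setTI.
  exact: (le_lt_trans (probability_le1 _ (measurable_open_edge _)) (ltry _)).
Qed.

(** * Percolation probabilities *)

Lemma measurable_open_pair (d : nat) (f : {fset 'rV[int]_d.+1}) :
  measurable [set w : config_space d | exists e : @bcc_edge d,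
    val e = f /\ w e].
Proof.
have [[e ef]|noe] := pselect (exists e : @bcc_edge d, val e = f).
  have -> : [set w : config_space d | exists e : @bcc_edge d,
      val e = f /\ w e] = [set w : config_space d | w e].
    apply/seteqP; split=> [w [e' [e'f]]|w we]; last by exists e.
    by have /val_inj -> : val e' = val e by rewrite e'f ef.
  exact: measurable_open_edge.
rewrite (_ : [set w | _] = set0); first exact: measurable0.
by apply/seteqP; split=> // w [e [ef _]]; apply: noe; exists e.
Qed.

Lemma measurable_open_path (d : nat) (x : 'rV[int]_d.+1)
    (s : seq 'rV[int]_d.+1) :
  measurable ([set w | is_open_path w x s] : set (config_space d)).
Proof.
apply: (bigcap_measurableType (T := config_space d)
  (F := fun i => [set w | exists e : @bcc_edge d,
    val e = [fset nth x (x :: s) i; nth x (x :: s) i.+1]%fset /\ w e])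
  (P := [set i | (i < size s)%N])) => i _.
exact: measurable_open_pair.
Qed.

(** The cluster is infinite when for every finite set of vertices some open
backbend path ends outside it; there are countably many finite sets and
countably many paths. *)
Lemma measurable_infinite_cluster (d : nat) (gamma : backbend_seq)
    (V' : set 'rV[int]_d.+1) :
  measurable ([set w | infinite_set (backbend_cluster gamma V' w)] :
    set (config_space d)).
Proof.
pose hit (F : {fset 'rV[int]_d.+1}) (s : seq 'rV[int]_d.+1) :=
  [set w : config_space d | (is_backbend_path gamma V' 0 s /\ last 0 s \notin F)
    /\ is_open_path w 0 s].
have -> : [set w | infinite_set (backbend_cluster gamma V' w)] =
    ~` \bigcup_(F : {fset 'rV[int]_d.+1}) ~` \bigcup_s hit F s.
  apply/seteqP; split=> [w infC [F _ CF]|w infC /finite_fsetP[F CF]].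
    apply: infC; apply: sub_finite_set (finite_fset F) => y [s [bs os sy]].
    apply/negP => yF; apply: CF; exists s => //; split=> //.
    by split=> //; rewrite sy; exact/negP.
  apply: infC; exists F => // -[s _ [[bs /negP sF] os]].
  apply: sF; have : backbend_cluster gamma V' w (last 0 s) by exists s.
  by rewrite CF.
apply: measurableC; apply: countable_bigcupT_measurable => [|F].
  exact: countableP.
apply: measurableC; apply: countable_bigcupT_measurable => [|s].
  exact: countableP.
have [c|nc] := pselect (is_backbend_path gamma V' 0 s /\ last 0 s \notin F).
  rewrite (_ : hit F s = [set w | is_open_path w 0 s]).
    exact: measurable_open_path.
  by apply/seteqP; split=> w // [].
rewrite (_ : hit F s = set0); first exact: measurable0.
by apply/seteqP; split=> // w [].
Qed.

Lemma theta_le (R : realType) (d : nat) (P : probability (config_space d) R)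
    (gamma' gamma : backbend_seq) (V' : set 'rV[int]_d.+1) :
  (forall i, le_infty (gamma' i) (gamma i)) ->
  (theta P gamma' V' <= theta P gamma V')%E.
Proof.
move=> le_gamma; apply: le_measure; rewrite ?inE.
- exact: measurable_infinite_cluster.
- exact: measurable_infinite_cluster.
move=> w; apply: contra_not; apply: sub_finite_set => y [s [[h0 ps bs] os sy]].
exists s; split=> //; split=> // i /bs /=.
have := le_gamma `|record_level 0 s i|%N.
by case: (gamma' _) (gamma _) => [a|] [b|] //=; lia.
Qed.

Lemma theta_shift_seq_le (R : realType) (d : nat) (p : R)
    (P : probability (config_space d) R) (gamma : backbend_seq) :
  0 <= p -> is_bernoulli_product p P ->
  (p%:E * theta P (shift_seq gamma) (@half_space d)
    <= theta P gamma (@half_space d))%E.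
Proof.
move=> p0 hP; rewrite -(bernoulli_shift_config p0 hP); last first.
  exact: measurable_infinite_cluster.
apply: le_measure; rewrite ?inE.
- apply: measurableI; last exact: measurable_open_edge.
  rewrite -[X in measurable X]setTI; apply: measurable_shift_config => //.
  exact: measurable_infinite_cluster.
- exact: measurable_infinite_cluster.
- by move=> w [infC w0]; exact: backbend_cluster_shift.
Qed.

Lemma theta_iter_shift_seq_gt0 (R : realType) (d : nat) (p : R)
    (P : probability (config_space d) R) (gamma : backbend_seq) (n : nat) :
  0 < p -> is_bernoulli_product p P ->
  (0 < theta P (iter n shift_seq gamma) (@half_space d))%E ->
  (0 < theta P gamma (@half_space d))%E.
Proof.
move=> p0 hP; elim: n => [//|n IHn] h; apply: IHn.
apply: lt_le_trans (theta_shift_seq_le _ (ltW p0) hP).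
by rewrite mule_gt0.
Qed.

(** An infinite cluster contains a vertex other than the origin, hence forces an
open edge, and each of the countably many edges is open with probability 0. *)
Lemma theta_bernoulli0 (R : realType) (d : nat)
    (P : probability (config_space d) R) (gamma : backbend_seq)
    (V' : set 'rV[int]_d.+1) :
  is_bernoulli_product 0 P -> theta P gamma V' = 0%E.
Proof.
move=> hP; apply/negligibleP; first exact: measurable_infinite_cluster.
pose F (n : nat) : set (config_space d) :=
  [set w | exists e : @bcc_edge d, choice.pickle (val e) = n /\ w e].
apply: (@negligibleS _ _ _ P (\bigcup_n F n)).
  move=> w infC; apply: contrapT => noF; apply: infC.
  (* With all edges closed only the empty path, which ends at 0, is open. *)
  apply: sub_finite_set (finite_set1 0) => y [[|z s] [_ os <-]] //.
  have [//|e [_ we]] := os 0%N.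
  by exfalso; apply: noF; exists (choice.pickle (val e)) => //; exists e.
apply: negligible_bigcup => n.
have [[e en]|noe] :=
  pselect (exists e : @bcc_edge d, choice.pickle (val e) = n).
  have -> : F n = all_open [fset e]%fset.
    apply/seteqP; split=> [w [e' [e'n we']] e''|w we].
      rewrite inE => /eqP ->; suff -> : e = e' by [].
      by apply/val_inj/(pcan_inj choice.pickleK); rewrite en e'n.
    by exists e; split=> //; apply: we; rewrite inE.
  apply/negligibleP; first exact: measurable_all_open.
  by have := bernoulli_all_open [fset e]%fset hP; rewrite cardfs1 expr1.
suff -> : F n = set0 by exact: negligible_set0.
by apply/seteqP; split=> // w [e [en _]]; apply: noe; exists e.
Qed.

(** * Eventually equal backbend sequences *)

Lemma iter_shift_seqE (gamma : backbend_seq) (n i : nat) :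
  iter n shift_seq gamma i = gamma (n + i)%N.
Proof. by elim: n i => //= n IHn i; rewrite [LHS]IHn addnS. Qed.

Lemma k_cyclicE (k : nat) (beta : backbend_seq) (n i : nat) :
  k_cyclic k beta -> (i < k)%N -> beta (k * n + i)%N = beta i.
Proof.
by move=> hcyc ik; case: n => [|n]; [rewrite muln0|exact: (hcyc i ik).2].
Qed.

Lemma converges_from_below_le (k : nat) (beta' beta : backbend_seq) (i : nat) :
  (0 < k)%N -> k_cyclic k beta -> converges_from_below k beta' beta ->
  le_infty (beta' i) (beta i).
Proof.
move=> k0 hcyc hconv; have ik : (i %% k < k)%N by rewrite ltn_mod.
rewrite (divn_eq i k) mulnC (k_cyclicE _ hcyc ik); exact: (hconv _ ik).2.
Qed.

Lemma cvg_to_Some_eventually (u : nat -> one_point_compactification nat)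
    (m : nat) :
  u @ \oo --> (Some m : one_point_compactification nat) ->
  \forall n \near \oo, u n = Some m.
Proof.
move=> um.
have mm : nbhs m [set m] by exact: discrete_set1.
have h := um _ (one_point_compactification_some_nbhs _ _ mm).
by apply: (filterS _ (h : \forall n \near \oo, _ (u n))) => n [_ -> <-].
Qed.

(** The number of deleted terms is a multiple of [k], so that residue classes
keep their places and the periodicity of [beta] can be used. *)
Lemma iter_shift_seq_eventually (k : nat) (beta' beta : backbend_seq) :
  (0 < k)%N -> k_cyclic k beta -> converges_from_below k beta' beta ->
  exists n, iter n shift_seq beta' = beta.
Proof.
move=> k0 hcyc hconv.
have : \forall n \near \oo, forall i : 'I_k, beta' (k * n + i)%N = beta i.
  apply: filter_forall => i.
  have [[m bm] _] := hcyc i (ltn_ord i).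
  by have [+ _] := hconv i (ltn_ord i); rewrite bm => /cvg_to_Some_eventually.
move=> [M _ HM]; exists (k * M)%N; apply/funext => j.
have jk : (j %% k < k)%N by rewrite ltn_mod.
rewrite iter_shift_seqE (divn_eq j k) (mulnC _ k) addnA -mulnDr.
rewrite (k_cyclicE _ hcyc jk).
exact: (HM (M + j %/ k)%N (leq_addr _ _) (Ordinal jk)).
Qed.

Theorem theorem3p1 (R : realType) (d : nat) (hd : (2 <= d.+1)%N)
    (k : nat) (hk : (0 < k)%N) (beta' beta : backbend_seq)
    (hcyc : k_cyclic k beta) (hconv : converges_from_below k beta' beta)
    (p : R) (hp : 0 <= p <= 1)
    (P : probability (config_space d) R) (hP : is_bernoulli_product p P) :
  (0 < theta P beta' (@half_space d))%E <-> (0 < theta P beta (@half_space d))%E.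
Proof.
split=> [theta_gt0|theta_gt0].
  apply: lt_le_trans theta_gt0 _; apply: theta_le => i.
  exact: converges_from_below_le hconv.
have {hp}/andP[p_ge0 _] := hp.
move: p_ge0; rewrite le_eqVlt => /predU1P[p0|p_gt0].
  by move: hP theta_gt0; rewrite -p0 => /theta_bernoulli0 ->; rewrite ltxx.
have [n beta_n] := iter_shift_seq_eventually hk hcyc hconv.
by apply: (@theta_iter_shift_seq_gt0 _ _ p P _ n); rewrite ?beta_n.
Qed.
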